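(* Let $(X,\|\cdot\|)$ be a real Banach space, let $K\subset X$ be a cone, let $y\in X$ and put $K_y:=y+K=\{y+x: x\in K\}$. Let $D\subset X$ be an open bounded set, put $D_{K_y}:=D\cap K_y$, and suppose that $y\in D_{K_y}$ and $\overline{D}_{K_y}\neq K_y$. Assume that $\mathcal{F}:\overline{D}_{K_y}\to K$ is a compact map and that $$\inf_{x\in\partial D_{K_y}}\|\mathcal{F}(x)\|>0.$$ Then there exist $x^*\in\partial D_{K_y}$ and $\lambda^*\in(0,+\infty)$ such that $x^*=y+\lambda^*\mathcal{F}(x^* )$.
   Context: A cone $K$ of a real Banach space $X$ is a closed set with $K+K\subset K$, $\mu K\subset K$ for all $\mu\ge 0$, and $K\cap(-K)=\{0\}$. For $D\subset X$ open and bounded, $D_{K_y}=D\cap K_y$ is open in $K_y$, and $\overline{D}_{K_y}$ and $\partial D_{K_y}$ denote the closure and the boundary of $D_{K_y}$ relative to $K_y$. A compact map is a continuous map sending bounded sets to relatively compact sets. *)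

(* Defs.v *)
From HB Require Import structures.
From mathcomp Require Import all_boot all_order all_algebra.
From mathcomp Require Import all_classical all_reals all_analysis.
Set Implicit Arguments.
Unset Strict Implicit.
Unset Printing Implicit Defensive.
Import Order.TTheory GRing.Theory Num.Theory.
Import numFieldNormedType.Exports.
Local Open Scope classical_set_scope.
Local Open Scope ring_scope.

(* In [subspace S] every point outside S is isolated, hence the explicit
   intersection with S. *)
Definition rel_closure (T : topologicalType) (S A : set T) : set T :=
  S `&` @closure (subspace S) A.

Definition rel_boundary (T : topologicalType) (S A : set T) : set T :=
  rel_closure S A `\` @interior (subspace S) A.

Definition is_cone (R : realType) (X : normedModType R) (K : set X) : Prop :=
  [/\ closed K,
      forall u v : X, K u -> K v -> K (u + v),
      forall (mu : R) (u : X), 0 <= mu -> K u -> K (mu *: u)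
    & K `&` [set - u | u in K] = [set 0]].

Definition translate (R : realType) (X : normedModType R) (y : X) (K : set X)
  : set X := [set y + x | x in K].

(* A map A -> B is represented by a total function f together with its
   domain A; the values of f outside A are never used. *)
Definition compact_map (R : realType) (X Y : normedModType R)
    (A : set X) (B : set Y) (f : X -> Y) : Prop :=
  [/\ f @` A `<=` B,
      {within A, continuous f}
    & forall C : set X, C `<=` A -> bounded_set C -> precompact (f @` C)].

(* Main.v *)
Require Import Defs.
From HB Require Import structures.
From mathcomp Require Import all_boot all_order all_algebra.
From mathcomp Require Import all_classical all_reals all_analysis.
From mathcomp Require Import fingroup perm finmap zify ring lra.
Set Implicit Arguments.
Unset Strict Implicit.
Unset Printing Implicit Defensive.
Import Order.TTheory GRing.Theory Num.Theory.
Import numFieldNormedType.Exports.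
Local Open Scope classical_set_scope.
Local Open Scope ring_scope.

(** Write C for the closure of DKy and B for its boundary in Ky. If z_1, ..., z_n
is a fine net of the compact closure of F(B), the map F is approximated on B by a
combination sum_i p_i(x) z_i with continuous convex weights p_i, which extend to
the whole space. Let s be a continuous function which on Ky is positive on DKy,
negative outside C and zero on B. Brouwer's theorem applied to
   a |-> clip_[0,L](sum_i a_i + s(x_a)) p(x_a),   x_a = y + sum_i a_i z_i,
gives x = y + l sum_i p_i(x) z_i with l = clip(l + s(x)). Since s(y) > 0, l is
positive; since the convex hull of finitely many nonzero elements of a cone
avoids 0, a large L excludes l = L with x in C. Hence s(x) = 0, that is, x lies
on B. Refining the net and passing to the limit by compactness gives the result.

Brouwer's theorem is derived from a Sperner-type lemma on the discrete torus
(Z/K)^n: each facet of the Freudenthal triangulation is shared by two simplices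
of opposite orientation, so the signed number of fully labelled simplices is zero
for every labelling. Two labellings which agree on the boundary of the box have
therefore the same signed number of fully labelled simplices inside it, and this
number is +1 or -1 for the labelling of the map x |-> 0. *)

(** * Signed count of fully labelled simplices on the discrete torus *)

(* The vertices j = 0, ..., m+1 of the Freudenthal simplex based at z: coordinate
   c is raised, modulo k+2, at step r c. *)
Definition grid_vertex (m k : nat) (z : {ffun 'I_m.+1 -> 'I_k.+2})
    (r : 'S_m.+1) (j : nat) : {ffun 'I_m.+1 -> 'I_k.+2} :=
  z + [ffun c => (r c < j)%N%:R].

(** Each row is the indicator of one label, so the determinant is 1 or -1 when the simplex carries
    all the labels and 0 otherwise. *)
Definition label_matrix (m k : nat)
    (L : {ffun 'I_m.+1 -> 'I_k.+2} -> 'I_m.+2)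
    (z : {ffun 'I_m.+1 -> 'I_k.+2}) (r : 'S_m.+1) : 'M[int]_m.+2 :=
  \matrix_(j, l) (L (grid_vertex z r j) == l)%:R.

(** Vertex [j] and label [ord_max] are dropped. A vertex labelled [ord_max] gives a zero row, so
    only facets carrying each of the labels 0, ..., m have a nonzero determinant. *)
Definition facet_matrix (m k : nat)
    (L : {ffun 'I_m.+1 -> 'I_k.+2} -> 'I_m.+2)
    (z : {ffun 'I_m.+1 -> 'I_k.+2}) (r : 'S_m.+1) (j : 'I_m.+2) : 'M[int]_m.+1 :=
  \matrix_(a, b) (L (grid_vertex z r (lift j a)) == lift ord_max b)%:R.

(* Adding all columns to the last one turns it into a column of ones, along
   which the determinant is then expanded. *)
Lemma det_label_matrix m k (L : {ffun 'I_m.+1 -> 'I_k.+2} -> 'I_m.+2) z r :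
  \det (label_matrix L z r) =
  \sum_(j < m.+2) (-1) ^+ (j + m.+1) * \det (facet_matrix L z r j).
Proof.
pose T : 'M[int]_m.+2 := \matrix_(l, l') ((l' == ord_max) || (l == l'))%:R.
have detT : \det T = 1.
  rewrite -det_tr det_trig ?big1 //.
    by move=> i _; rewrite !mxE eqxx orbT.
  apply/is_trig_mxP => i j ij; rewrite !mxE.
  have /negPf-> : j != i by apply: contraTneq ij => ->; rewrite ltnn.
  have /negPf-> // : i != ord_max.
  by apply: contraTneq ij => ->; rewrite -leqNgt -ltnS.
have -> : \det (label_matrix L z r) = \det (label_matrix L z r *m T).
  by rewrite det_mulmx detT mulr1.
have MT j l : (label_matrix L z r *m T) j l =
    ((l == ord_max) || (L (grid_vertex z r j) == l))%:R.
  rewrite mxE (bigD1 (L (grid_vertex z r j))) //= !mxE eqxx mul1r.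
  rewrite big1 ?addr0 // => i /negPf ne; rewrite !mxE eq_sym ne mul0r //.
rewrite (expand_det_col _ ord_max); apply: eq_bigr => j _.
rewrite MT eqxx mul1r /cofactor; congr (_ * \det _).
apply/matrixP => a b; rewrite mxE mxE MT mxE.
by rewrite eq_sym (negPf (neq_lift _ _)).
Qed.

(** Swapping two consecutive ranks alters only the set of coordinates of rank below [i'], hence
    moves the vertex [i'] alone. *)
Lemma grid_vertex_tperm m k (z : {ffun 'I_m.+1 -> 'I_k.+2}) (r : 'S_m.+1)
    (i i' : 'I_m.+1) (j : nat) : i' = i.+1 :> nat -> j != i' ->
  grid_vertex z (r * tperm i i')%g j = grid_vertex z r j.
Proof.
move=> ii' ji; congr (_ + _); apply/ffunP => c; rewrite !ffunE permM.
congr (nat_of_bool _)%:R.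
case: tpermP => [->|->|//]; move: ji; rewrite ii' => /negPf ji.
  by rewrite (ltn_neqAle i.+1 j) eq_sym ji.
by rewrite (ltn_neqAle i.+1 j) eq_sym ji.
Qed.

(** Swapping the ranks j-1 and j keeps the facet opposite to vertex [j] and reverses the sign of
    [r], so the sum equals its own opposite. *)
Lemma sum_facet_inner m k (L : {ffun 'I_m.+1 -> 'I_k.+2} -> 'I_m.+2) z
    (j : 'I_m.+2) : (0 < j < m.+1)%N ->
  \sum_(r : 'S_m.+1) (-1) ^+ r * \det (facet_matrix L z r j) = 0.
Proof.
move=> /andP[j0 jm]; set S := \sum_(r : _) _.
have i0 : (j.-1 < m.+1)%N by rewrite (leq_ltn_trans (leq_pred _)).
pose i := Ordinal i0; pose i' := Ordinal jm.
have ii' : i' = i.+1 :> nat by rewrite /= prednK.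
suff : S = - S by lia.
rewrite {1}/S (reindex_inj (mulIg (tperm i i'))) /= /S -sumrN.
apply: eq_bigr => r _.
rewrite odd_permM odd_tperm -val_eqE /= neq_ltn prednK // leqnn addbT.
rewrite signrN mulNr; congr (- (_ * \det _)).
apply/matrixP => a b; rewrite !mxE (grid_vertex_tperm _ _ ii') //.
by rewrite eq_sym neq_bump.
Qed.

(* The ranks are shifted cyclically, so that the facet opposite to the first
   vertex of a simplex is the facet opposite to the last vertex of the next. *)
Lemma sum_facet_outer m k (L : {ffun 'I_m.+1 -> 'I_k.+2} -> 'I_m.+2) :
  \sum_(r : 'S_m.+1) \sum_z (-1) ^+ r * \det (facet_matrix L z r ord_max) =
  (-1) ^+ m * \sum_(r : 'S_m.+1) \sum_z (-1) ^+ r * \det (facet_matrix L z r ord0).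
Proof.
(* [rho] sends rank 0 to m and rank i+1 to i: a cycle of sign (-1)^m. *)
pose rho : 'S_m.+1 := lift_perm ord0 ord_max 1%g.
rewrite (reindex_inj (mulIg rho)) /= mulr_sumr; apply: eq_bigr => r _.
rewrite (reindex_inj (addIr [ffun c => (r c == ord0)%:R])) /= mulr_sumr.
apply: eq_bigr => z _; rewrite mulrA.
congr (_ * _).
  rewrite odd_permM odd_lift_perm odd_perm1 addbF /= signr_addb mulrC.
  by rewrite signr_odd.
congr (\det _); apply/matrixP => a b; rewrite !mxE; congr (L _ == _)%:R.
rewrite /grid_vertex -addrA; congr (_ + _); apply/ffunP => c.
rewrite !ffunE permM -natrD; congr (_%:R).
have -> : lift ord_max a = a :> nat by rewrite /= /bump leqNgt ltn_ord.
case: (unliftP ord0 (r c)) => [i ->|->]; last first.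
  by rewrite lift_perm_id eqxx /= ltnNge -ltnS ltn_ord.
have ni : (lift ord0 i == ord0) = false by rewrite eq_sym (negPf (neq_lift _ _)).
have mi : lift ord_max i = i :> nat by rewrite /= /bump leqNgt ltn_ord.
by rewrite lift_perm_lift perm1 ni mi.
Qed.

(** In the expansion along facets the inner ones cancel for each base separately, and the two outer
    families cancel each other through the cyclic shift. *)
Lemma sum_det_label_matrix m k (L : {ffun 'I_m.+1 -> 'I_k.+2} -> 'I_m.+2) :
  \sum_(r : 'S_m.+1) \sum_z (-1) ^+ r * \det (label_matrix L z r) = 0.
Proof.
pose h j := \sum_(r : 'S_m.+1) \sum_z (-1) ^+ r * \det (facet_matrix L z r j).
have -> : \sum_(r : 'S_m.+1) \sum_z (-1) ^+ r * \det (label_matrix L z r) =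
    \sum_(j < m.+2) (-1) ^+ (j + m.+1) * h j.
  under [RHS]eq_bigr => j _ do rewrite mulr_sumr.
  rewrite [RHS]exchange_big; apply: eq_bigr => r _ /=.
  under [RHS]eq_bigr => j _ do rewrite mulr_sumr.
  rewrite [RHS]exchange_big; apply: eq_bigr => z _ /=.
  rewrite det_label_matrix mulr_sumr; apply: eq_bigr => j _.
  by rewrite mulrCA.
rewrite big_ord_recl big_ord_recr /= big1 ?add0r.
  rewrite [lift _ _](_ : _ = ord_max); last exact/val_inj.
  rewrite [h ord_max]sum_facet_outer -/(h ord0) -[in X in _ + X]signr_odd oddD.
  by rewrite addbb mul1r add0n exprS mulN1r mulNr addNr.
move=> i _; rewrite /h exchange_big big1 ?mulr0 //= => z _.
by apply: sum_facet_inner; rewrite /= /bump /= ltnS ltn_ord.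
Qed.

(** * Labellings of the grid and existence of a fully labelled simplex *)

(* The value is ord_max when P never holds. *)
Definition first_index (m : nat) (P : pred 'I_m.+1) : 'I_m.+2 :=
  inord (find P (enum 'I_m.+1)).

Lemma first_indexE m (P : pred 'I_m.+1) :
  first_index P = find P (enum 'I_m.+1) :> nat.
Proof.
rewrite inordK // ltnS (leq_trans (find_size _ _)) // size_enum_ord //.
Qed.

Lemma first_index_before m (P : pred 'I_m.+1) (i : 'I_m.+1) :
  (i < first_index P)%N -> ~~ P i.
Proof.
by rewrite first_indexE => /(before_find ord0); rewrite nth_ord_enum => ->.
Qed.

Lemma first_index_at m (P : pred 'I_m.+1) (i : 'I_m.+1) :
  first_index P = i :> nat -> P i.
Proof.
rewrite first_indexE => fi.
have hP : has P (enum 'I_m.+1) by rewrite has_find fi size_enum_ord.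
by have := nth_find ord0 hP; rewrite fi nth_ord_enum.
Qed.

Lemma first_index_max m (P : pred 'I_m.+1) :
  (forall i, ~~ P i) -> first_index P = ord_max.
Proof.
move=> nP; apply/val_inj/eqP; rewrite eqn_leq -ltnS ltn_ord /= leqNgt.
by apply/negP => lt; have := @first_index_at _ P (Ordinal lt) erefl; apply/negP.
Qed.

Lemma first_index_eq m (P : pred 'I_m.+1) (i : 'I_m.+1) :
  P i -> (forall j : 'I_m.+1, (j < i)%N -> ~~ P j) -> first_index P = i :> nat.
Proof.
move=> Pi nP; case: (ltngtP (first_index P) i) => // [lt|lt].
  have lt' : (first_index P < m.+1)%N by exact: ltn_trans lt _.
  have /negP[] := nP (Ordinal lt') lt.
  by have := @first_index_at _ P (Ordinal lt') erefl.
by have := first_index_before lt; rewrite Pi.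
Qed.

Lemma first_index_anti m (P P' : pred 'I_m.+1) :
  subpred P P' -> (first_index P' <= first_index P)%N.
Proof.
move=> PP'; rewrite leqNgt; apply/negP => lt.
have lt' : (first_index P < m.+1)%N by rewrite (leq_trans lt) // -ltnS.
have := @first_index_at _ P (Ordinal lt') erefl.
move=> /PP'; apply/negP; exact: (@first_index_before _ P' (Ordinal lt')).
Qed.

(** This is the labelling of the zero map when the origin lies between the indices [q] and [q.+1]:
    the label is the first coordinate that exceeds its image 0. *)
Definition orthant_label (m k q : nat) (v : {ffun 'I_m.+1 -> 'I_k.+2}) : 'I_m.+2 :=
  first_index (fun c => (q < v c)%N).

(** The bound on [z c] excludes wrapping round the torus in coordinate [c]. *)
Lemma grid_vertexE m k (z : {ffun 'I_m.+1 -> 'I_k.+2}) (r : 'S_m.+1) j c :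
  (z c < k.+1)%N -> grid_vertex z r j c = (z c + (r c < j))%N :> nat.
Proof.
move=> zc; rewrite /grid_vertex !ffunE /=.
by case: (r c < j)%N; rewrite /= !modn_small ?addn0 ?addn1 //= ltnW.
Qed.

Lemma det_label_matrix_inj m k (L : {ffun 'I_m.+1 -> 'I_k.+2} -> 'I_m.+2) z r :
  \det (label_matrix L z r) != 0 ->
  injective (fun j : 'I_m.+2 => L (grid_vertex z r j)).
Proof.
move=> D j j' /= e; apply: contraNeq D => jj'.
apply/eqP/(determinant_alternate jj') => l; by rewrite !mxE e.
Qed.

(** Raising coordinates can only lower the label, so distinct labels must run m+1, ..., 0 along the
    vertices. Coordinate [c] therefore exceeds [q] for the first time at vertex m+1-c. *)
Lemma orthant_label_full m k q (z : {ffun 'I_m.+1 -> 'I_k.+2}) (r : 'S_m.+1) :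
  (forall c, z c < k.+1)%N ->
  injective (fun j : 'I_m.+2 => orthant_label q (grid_vertex z r j)) ->
  (forall c, z c = q :> nat) /\ (forall c, r c = rev_ord c).
Proof.
move=> zk inj; pose l j := orthant_label q (grid_vertex z r j).
have anti j : (l j.+1 <= l j)%N.
  apply: first_index_anti => c; rewrite !grid_vertexE // => /leq_trans; apply.
  by rewrite leq_add2l; case: ltnP; case: ltnP => //; lia.
have decr i j : (i + j <= m.+1)%N -> (l (i + j)%N + j <= l i)%N.
  elim: j => [|j IH]; first by rewrite !addn0.
  rewrite addnS => ij; apply: leq_trans (IH (ltnW ij)).
  rewrite addnS -addSn leq_add2r ltn_neqAle anti andbT.
  apply/eqP => /val_inj e.
  have ij' : (i + j < m.+2)%N by rewrite ltnW.
  by have := @inj (@Ordinal m.+2 (i + j).+1 ij) (Ordinal ij') e => -[]; lia.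
have lE j : (j <= m.+1)%N -> l j = (m.+1 - j)%N :> nat.
  move=> jm; have := @decr 0%N j jm.
  have := @decr j (m.+1 - j)%N; rewrite subnKC // => /(_ (leqnn _)).
  have : (l 0%N <= m.+1)%N by rewrite -ltnS.
  by rewrite add0n; lia.
have before j (c : 'I_m.+1) : (c < l j)%N -> (grid_vertex z r j c <= q)%N.
  by move=> cl; rewrite leqNgt; apply: first_index_before cl.
have at_ j (c : 'I_m.+1) : l j = c :> nat -> (q < grid_vertex z r j c)%N.
  exact: first_index_at.
have z_le c : (z c <= q)%N.
  by have := @before 0%N c; rewrite lE // subn0 grid_vertexE // addn0; apply.
have zr (c : 'I_m.+1) : z c = q :> nat /\ r c = rev_ord c :> nat.
  have cm : (c <= m)%N by rewrite -ltnS.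
  have := @at_ (m.+1 - c)%N c; rewrite lE ?leq_subr // subKn ?(leqW cm) //.
  move/(_ erefl); rewrite grid_vertexE // => h1.
  have : (grid_vertex z r (m - c) c <= q)%N.
    by apply: before; rewrite lE; lia.
  rewrite grid_vertexE //= subSS; have := z_le c; move: h1.
  by case: ltnP; case: ltnP; lia.
by split=> c; [have [] := zr c | apply: val_inj; have [] := zr c].
Qed.

(** Simplices that wrap round the torus see boundary labels only, so they contribute equally for [L]
    and for the orthant labelling. As both totals vanish, the counts of the remaining simplices
    agree too. *)
Lemma exists_full_simplex m k q (L : {ffun 'I_m.+1 -> 'I_k.+2} -> 'I_m.+2) :
  (q <= k)%N ->
  (forall v : {ffun 'I_m.+1 -> 'I_k.+2},
    (exists c, v c = ord0 \/ v c = ord_max) -> L v = orthant_label q v) ->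
  exists (z : {ffun 'I_m.+1 -> 'I_k.+2}) (r : 'S_m.+1),
    (forall c, z c < k.+1)%N /\
    injective (fun j : 'I_m.+2 => L (grid_vertex z r j)).
Proof.
move=> qk LE; apply: contrapT => nex.
pose N (z : {ffun 'I_m.+1 -> 'I_k.+2}) := [forall c, (z c < k.+1)%N].
pose S (P : pred {ffun 'I_m.+1 -> 'I_k.+2}) L' :=
  \sum_(r : 'S_m.+1) \sum_(z | P z) (-1) ^+ r * \det (label_matrix L' z r) : int.
have splitS L' : S N L' + S (predC N) L' = 0.
  rewrite -(sum_det_label_matrix L') -big_split; apply: eq_bigr => r _ /=.
  by rewrite [RHS](bigID N).
have SL : S N L = 0.
  apply: big1 => r _; apply: big1 => z /forallP zN.
  have [->|/det_label_matrix_inj inj] := eqVneq (\det (label_matrix L z r)) 0.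
    by rewrite mulr0.
  by case: nex; exists z, r.
have SC : S (predC N) L = S (predC N) (@orthant_label m k q).
  apply: eq_bigr => r _; apply: eq_bigr => z /=; rewrite negb_forall.
  move=> /existsP[c zc]; congr (_ * \det _).
  apply/matrixP => j l; rewrite !mxE LE //; exists c.
  rewrite /grid_vertex !ffunE.
  (* A base that wraps has a maximal coordinate, which is kept or becomes 0 at each vertex: all the
     vertices lie on the boundary. *)
  have -> : z c = ord_max.
    by apply/val_inj/eqP; rewrite eqn_leq -ltnS ltn_ord /= leqNgt.
  case: (r c < j)%N; rewrite ?addr0; [left|by right].
  by apply: val_inj; rewrite /= (@modn_small 1) // addn1 modnn.
have /eqP : S N (@orthant_label m k q) = 0.
  have := splitS L; rewrite SL SC add0r => e.
  by have := splitS (@orthant_label m k q); rewrite e addr0.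
apply/negP.
(* The unique simplex with a nonzero contribution for the orthant labelling; its labels come in
   reverse order. *)
pose z0 : {ffun 'I_m.+1 -> 'I_k.+2} := [ffun=> inord q].
have z0E c : z0 c = q :> nat by rewrite ffunE inordK // ltnS ltnW.
have Nz0 c : (z0 c < k.+1)%N by rewrite z0E.
pose r0 : 'S_m.+1 := perm (@rev_ord_inj m.+1).
have L0 (j : 'I_m.+2) : orthant_label q (grid_vertex z0 r0 j) = rev_ord j.
  have vE c : grid_vertex z0 r0 j c = (q + (rev_ord c < j))%N :> nat.
    by rewrite grid_vertexE // z0E permE.
  case: (posnP j) => [j0|jp].
    have -> : j = ord0 by apply: val_inj.
    rewrite [RHS](_ : _ = ord_max); last by apply: val_inj; rewrite /= subn1.
    by apply: first_index_max => c; rewrite -leqNgt grid_vertexE // z0E ltn0 addn0.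
  have lt : (m.+1 - j < m.+1)%N by lia.
  apply: val_inj; rewrite /= subSS.
  apply: (@first_index_eq _ _ (Ordinal lt)) => [|i /=].
    by rewrite vE /=; case: ltnP => //; have := ltn_ord j; lia.
  by rewrite vE /= -leqNgt; case: ltnP; have := ltn_ord j; have := ltn_ord i; lia.
rewrite /S (bigD1 r0) //= [X in _ + X]big1 ?addr0; last first.
  move=> r rr0; apply: big1 => z /forallP zN.
  have [->|/det_label_matrix_inj inj] :=
    eqVneq (\det (label_matrix (@orthant_label m k q) z r)) 0; first by rewrite mulr0.
  have [_ rE] := orthant_label_full zN inj.
  by case/eqP: rr0; apply/permP => c; rewrite rE permE.
rewrite (bigD1 z0) /=; last exact/forallP.
rewrite [X in _ + X]big1 ?addr0; last first.
  move=> z /andP[/forallP zN zz0].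
  have [->|/det_label_matrix_inj inj] :=
    eqVneq (\det (label_matrix (@orthant_label m k q) z r0)) 0; first by rewrite mulr0.
  have [zE _] := orthant_label_full zN inj.
  by case/eqP: zz0; apply/ffunP => c; apply: val_inj; rewrite /= zE z0E.
have -> : label_matrix (@orthant_label m k q) z0 r0 =
    perm_mx (perm (@rev_ord_inj m.+2)).
  by apply/matrixP => j l; rewrite !mxE L0 permE.
by rewrite det_perm mulf_neq0 ?signr_eq0.
Qed.

(** * Continuity of pointwise operations *)

Section ContinuousFunctions.
Context {R : realType} {T : topologicalType} {V : normedModType R}.

Lemma continuous_fun_max (f g : T -> R) :
  continuous f -> continuous g -> continuous (fun x => Num.max (f x) (g x)).
Proof. by move=> cf cg x; exact: (@continuous_max R T f g x (cf x) (cg x)). Qed.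

Lemma continuous_fun_min (f g : T -> R) :
  continuous f -> continuous g -> continuous (fun x => Num.min (f x) (g x)).
Proof. by move=> cf cg x; exact: (@continuous_min R T f g x (cf x) (cg x)). Qed.

Lemma continuous_fun_add (f g : T -> V) :
  continuous f -> continuous g -> continuous (fun x => f x + g x).
Proof. by move=> cf cg x; exact: (cvgD (cf x) (cg x)). Qed.

Lemma continuous_fun_sub (f g : T -> V) :
  continuous f -> continuous g -> continuous (fun x => f x - g x).
Proof. by move=> cf cg x; exact: (cvgB (cf x) (cg x)). Qed.

Lemma continuous_fun_mul (f g : T -> R) :
  continuous f -> continuous g -> continuous (fun x => f x * g x).
Proof. by move=> cf cg x; exact: (cvgM (cf x) (cg x)). Qed.

Lemma continuous_fun_scale (f : T -> R) (g : T -> V) :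
  continuous f -> continuous g -> continuous (fun x => f x *: g x).
Proof. by move=> cf cg x; exact: (cvgZ (cf x) (cg x)). Qed.

Lemma continuous_fun_norm (f : T -> V) :
  continuous f -> continuous (fun x => `|f x|).
Proof. by move=> cf x; exact: (cvg_norm (cf x)). Qed.

Lemma continuous_fun_sum (I : Type) (r : seq I) (F : I -> T -> V) :
  (forall i, continuous (F i)) -> continuous (fun x => \sum_(i <- r) F i x).
Proof.
move=> cF; elim: r => [|i r IH].
  by under eq_fun do rewrite big_nil; exact: cst_continuous.
under eq_fun do rewrite big_cons.
exact: continuous_fun_add (cF i) IH.
Qed.

End ContinuousFunctions.

(** * Brouwer's fixed point theorem *)

Lemma compact_seq_cluster (R : realType) (V : normedModType R) (A : set V)
    (u : nat -> V) : compact A -> (forall n, A (u n)) ->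
  exists2 p, A p & forall e : R, 0 < e -> forall N : nat,
    exists2 n, (N <= n)%N & `|p - u n| < e.
Proof.
move=> cA Au; have FA : (u @ \oo) A by exists 0%N => // n _; exact: Au.
have [p [Ap clp]] := cA (u @ \oo) _ FA.
exists p => // e e0 N.
have [_ [[n /= Nn <-] pn]] := clp (u @` [set n | (N <= n)%N]) (ball p e)
  (ex_intro2 _ _ N I (fun n Nn => ex_intro2 _ _ n Nn erefl)) (nbhsx_ballx p e e0).
by exists n => //; move: pn; rewrite -ball_normE.
Qed.

Lemma mx_norm_coord_le (R : realType) (m n : nat) (x : 'M[R]_(m, n)) i j :
  `|x i j| <= `|x|.
Proof.
by rewrite [leRHS]/Num.norm /= mx_normrE; apply/bigmax_geP; right => /=; exists (i, j).
Qed.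

Lemma mx_norm_le (R : realType) (m n : nat) (x : 'M[R]_(m, n)) (e : R) :
  0 <= e -> (forall i j, `|x i j| <= e) -> `|x| <= e.
Proof.
move=> e0 xe; rewrite [leLHS]/Num.norm /= mx_normrE; apply/bigmax_leP.
by split=> // -[i j] _; exact: xe.
Qed.

(** The 2q+2 indices cut [-M, M] into 2q+1 equal intervals. This number is odd, so 0 is no grid
    coordinate and lies midway between the indices [q] and [q.+1]. *)
Definition grid_point (R : realType) (m q : nat) (M : R)
    (v : {ffun 'I_m.+1 -> 'I_(q.*2).+2}) : 'rV[R]_m.+1 :=
  \row_i (M * ((v i).*2%:R / (q.*2).+1%:R - 1)).

Lemma grid_point_le (R : realType) (m q : nat) (M : R)
    (v : {ffun 'I_m.+1 -> 'I_(q.*2).+2}) : 0 < M -> `|grid_point M v| <= M.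
Proof.
move=> M0; apply: mx_norm_le => [|i j]; first exact: ltW.
rewrite mxE normrM gtr0_norm // ger_pMr // ler_norml lerBrDl subrr lerBlDr.
rewrite divr_ge0 //= ler_pdivrMr ?ltr0n // -mulr2n -natrM ler_nat.
by have := ltn_ord (v j); lia.
Qed.

Lemma grid_point_coord_gt0 (R : realType) (m q : nat) (M : R)
    (v : {ffun 'I_m.+1 -> 'I_(q.*2).+2}) i : 0 < M ->
  (0 < grid_point M v ord0 i) = (q < v i)%N.
Proof.
move=> M0; rewrite mxE pmulr_rgt0 // subr_gt0 ltr_pdivlMr ?ltr0n // mul1r ltr_nat.
by lia.
Qed.

Lemma grid_point_boundary (R : realType) (m q : nat) (M : R)
    (v : {ffun 'I_m.+1 -> 'I_(q.*2).+2}) i : 0 < M ->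
  v i = ord0 \/ v i = ord_max -> `|grid_point M v| = M.
Proof.
move=> M0 vi; apply/eqP; rewrite eq_le grid_point_le //=.
apply: le_trans (mx_norm_coord_le _ ord0 i); rewrite mxE.
case: vi => -> /=.
  by rewrite mul0r sub0r mulrN1 normrN gtr0_norm.
have -> : (q.*2.+1).*2%:R / (q.*2.+1)%:R = 2 :> R.
  by rewrite -muln2 natrM mulrAC divff ?mul1r // pnatr_eq0.
by rewrite (_ : 2 - 1 = 1) ?mulr1 ?gtr0_norm //; lra.
Qed.

Lemma grid_point_mesh (R : realType) (m q : nat) (M : R)
    (z : {ffun 'I_m.+1 -> 'I_(q.*2).+2}) r j : 0 < M ->
  (forall c, z c < q.*2.+1)%N ->
  `|grid_point M (grid_vertex z r j) - grid_point M z| <= M * 2 / (q.*2.+1)%:R.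
Proof.
move=> M0 zq; apply: mx_norm_le => [|i c].
  by rewrite !mulr_ge0 ?invr_ge0 // ltW.
rewrite !mxE grid_vertexE // -mulrBr opprB addrA subrK -mulrBl normrM gtr0_norm //.
rewrite -mulrA (ler_wpM2l (ltW M0)) // normrM ler_pM //.
  rewrite doubleD natrD addrAC subrr add0r normr_nat ler_nat.
  by case: ltnP.
by rewrite normfV normr_nat.
Qed.

(** A point is labelled by the first coordinate which [g] decreases strictly. Since [g] vanishes on
    the boundary of the box, the labels there are those of the zero map, so every grid has a fully
    labelled simplex. A cluster point of these simplices is fixed. *)
Lemma brouwer_collar (R : realType) (m : nat) (g : 'rV[R]_m.+1 -> 'rV[R]_m.+1)
    (M : R) : 0 < M -> continuous g -> (forall x, `|x| = M -> g x = 0) ->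
  exists x, g x = x.
Proof.
move=> M0 cg g0.
have approx q : exists x, let e := M * 2 / (q.*2.+1)%:R in [/\ `|x| <= M,
    forall i, exists2 x', `|x' - x| <= e & g x' ord0 i < x' ord0 i &
    exists2 x', `|x' - x| <= e & forall i, x' ord0 i <= g x' ord0 i].
  pose L (v : {ffun 'I_m.+1 -> 'I_(q.*2).+2}) := first_index (fun c =>
    g (grid_point M v) ord0 c < grid_point M v ord0 c) : 'I_m.+2.
  have [|v [c vc]|z [r [zq inj]]] := @exists_full_simplex m q.*2 q L.
  - by rewrite -addnn leq_addr.
  - congr first_index; apply/funext => i.
    by rewrite (g0 _ (grid_point_boundary M0 vc)) mxE grid_point_coord_gt0.
  have [h lh hl] := injF_bij inj.
  exists (grid_point M z); split=> [|i|]; first exact: grid_point_le.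
    exists (grid_point M (grid_vertex z r (h (lift ord_max i)))).
      exact: grid_point_mesh.
    have e : L (grid_vertex z r (h (lift ord_max i))) = i :> nat.
      by have /= -> := hl (lift ord_max i); rewrite /= /bump leqNgt ltn_ord.
    exact: (first_index_at e).
  exists (grid_point M (grid_vertex z r (h ord_max))).
    exact: grid_point_mesh.
  move=> i; rewrite leNgt.
  have e : (i < L (grid_vertex z r (h ord_max)))%N.
    by have /= -> := hl ord_max; exact: ltn_ord.
  exact: (first_index_before e).
have [u /all_and3[uM u_lt u_ge]] := choice approx.
have cB : compact [set x : 'rV[R]_m.+1 | `|x| <= M].
  apply: bounded_closed_compact.
    exists M; split=> [|y My]; first exact: num_real.
    move=> x /= /le_trans; apply; exact: ltW.
  rewrite (_ : mkset _ = (fun x => `|x|) @^-1` [set y | y <= M]) //.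
  apply: closed_comp; last exact: closed_le.
  by move=> x _; exact: norm_continuous.
have [p _ pu] := compact_seq_cluster cB uM.
have near_p (P : set 'rV[R]_m.+1) : nbhs p P ->
    exists q, forall x', `|x' - u q| <= M * 2 / (q.*2.+1)%:R -> P x'.
  move=> /nbhs_normP[e /= e0 eP].
  have e2 : 0 < e / 2 by rewrite divr_gt0.
  have [N Ne] : exists N, M * 2 / (e / 2) < N%:R.
    exists (Num.bound (M * 2 / (e / 2))).
    by rewrite archi_boundP // ltW // !(mulr_gt0, invr_gt0).
  have [q Nq pq] := pu _ e2 N.
  exists q => x' x'q; apply: eP => /=.
  rewrite -(subrKA (u q)) (le_lt_trans (ler_normD _ _)) // (splitr e) ltrD //.
  rewrite distrC (le_lt_trans x'q) // ltr_pdivrMr ?ltr0n // [ltRHS]mulrC -ltr_pdivrMr //.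
  by rewrite (lt_le_trans Ne) // ler_nat; lia.
have cc i : continuous (fun x => g x ord0 i - x ord0 i).
  move=> x; have cgi : {for x, continuous (fun x => g x ord0 i)}.
    apply: (@continuous_comp _ _ _ g (fun y : 'rV[R]_m.+1 => y ord0 i) x (cg x)).
    exact: coord_continuous.
  by apply: (cvgB cgi); exact: coord_continuous.
(* A strict inequality at [p] in coordinate [i] persists near [p]. One direction contradicts the
   vertex labelled [i], the other the vertex labelled [ord_max]. *)
exists p; apply/rowP => i; apply/eqP; rewrite eq_le !leNgt; apply/andP; split.
  apply/negP => h.
  have [q qP] := near_p [set x | 0 < g x ord0 i - x ord0 i]
    (cvgr_gt _ (cc i p) _ (etrans (subr_gt0 _ _) h)).
  have [x' /qP /=] := u_lt q i; rewrite subr_gt0 => a b.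
  by have := lt_trans a b; rewrite ltxx.
apply/negP => h.
have [q qP] := near_p [set x | g x ord0 i - x ord0 i < 0]
  (cvgr_lt _ (cc i p) _ (etrans (subr_lt0 _ _) h)).
have [x' /qP /= a /(_ i) b] := u_ge q; move: a; rewrite subr_lt0 => a.
by have := lt_le_trans a b; rewrite ltxx.
Qed.

Theorem brouwer (R : realType) (m : nat) (f : 'rV[R]_m.+1 -> 'rV[R]_m.+1) (M : R) :
  continuous f -> (forall x, `|f x| <= M) -> exists x, f x = x.
Proof.
move=> cf fM.
have [N N0 fN] : exists2 N : R, 0 < N & forall x, `|f x| <= N.
  exists (Num.max M 1); first by rewrite lt_max ltr01 orbT.
  by move=> x; rewrite le_max fM.
(* f is damped to 0 between the spheres of radii N and 2 N, where no fixed point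
   can appear since the values stay in the ball of radius N. *)
pose t (x : 'rV[R]_m.+1) : R := Num.max 0 (Num.min 1 (2 - `|x| / N)).
have ct : continuous t.
  apply: continuous_fun_max; first exact: cst_continuous.
  apply: continuous_fun_min; first exact: cst_continuous.
  apply: (@continuous_fun_sub _ _ R^o); first exact: cst_continuous.
  apply: continuous_fun_mul; last exact: cst_continuous.
  exact: norm_continuous.
have [||x|x gx] := @brouwer_collar R m (fun x => t x *: f x) (N * 2).
- by rewrite mulr_gt0.
- exact: continuous_fun_scale.
- move=> xN; rewrite /t xN (_ : 2 - _ = 0) ?(min_r, maxxx) ?scale0r //.
  by rewrite mulrAC divff ?mul1r ?subrr // gt_eqF.
have t1 : `|t x| <= 1.
  by rewrite ger0_norm ?le_max ?lexx // ge_max ler01 ge_min lexx.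
have xN : `|x| <= N.
  by rewrite -gx normrZ (le_trans _ (fN x)) // ler_piMl.
exists x; rewrite -[RHS]gx (_ : t x = 1) ?scale1r // /t min_l ?max_r //.
by rewrite lerBrDl -lerBrDr ler_pdivrMr //; lra.
Qed.

(** * Relative closure and boundary, and a signed distance *)

Lemma rel_closureE (T : topologicalType) (S A : set T) :
  A `<=` S -> rel_closure S A = S `&` closure A.
Proof.
move=> AS; apply/seteqP; split=> x [Sx clx]; split=> // B.
  move=> Bx; apply: clx; have : within S (nbhs x) B.
    by rewrite /within /=; apply: filterS Bx => z.
  by rewrite (nbhs_subspace_in Sx).
move=> Bx; have : within S (nbhs x) B by rewrite (nbhs_subspace_in Sx).
by move=> /clx[z [Az /(_ (AS z Az)) Bz]]; exists z.
Qed.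

(** As [D] is open, its trace on [S] is its own relative interior. *)
Lemma rel_boundaryE (T : topologicalType) (S D : set T) : open D ->
  rel_boundary S (D `&` S) = S `&` closure (D `&` S) `\` D.
Proof.
move=> oD; rewrite /rel_boundary rel_closureE //; apply/seteqP.
split=> x [[Sx clx] nDx]; split=> // Dx; apply: nDx.
  suff : within S (nbhs x) (D `&` S) by rewrite (nbhs_subspace_in Sx).
  rewrite /within /=; near=> z => Sz; split=> //.
  by near: z; exact: open_nbhs_nbhs.
have : within S (nbhs x) (D `&` S) by rewrite (nbhs_subspace_in Sx).
by move=> /nbhs_singleton /(_ Sx)[].
Unshelve. all: by end_near. Qed.

Lemma closure_dist (R : realType) (V : normedModType R) (A : set V) (x : V) :
  closure A x <-> forall e : R, 0 < e -> exists2 a, A a & `|x - a| < e.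
Proof.
split=> [clx e e0|h B /nbhs_normP[e /= e0 eB]].
  by have [a [Aa]] := clx _ (nbhsx_ballx x e e0); rewrite -ball_normE; exists a.
by have [a Aa xa] := h e e0; exists a; split=> //; exact: eB.
Qed.

Lemma bounded_closure (R : realType) (V : normedModType R) (A B : set V) :
  bounded_set A -> B `<=` A ->
  exists2 M : R, 0 < M & forall x, closure B x -> `|x| <= M.
Proof.
move=> [M [_ AM]] BA; pose N := Num.max (M + 1) 1.
exists (1 + N); first by rewrite ltr_wpDr // le_max ler01 orbT.
move=> x /closure_dist/(_ 1 ltr01)[a /BA Aa xa].
rewrite -(subrK a x) (le_trans (ler_normD _ _)) // lerD ?(ltW xa) //.
by apply: AM Aa; rewrite lt_max ltrDl ltr01.
Qed.

Definition inf_dist (R : realType) (V : normedModType R) (A : set V) (x : V) : R :=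
  inf [set `|x - a| | a in A].

Section InfDist.
Context {R : realType} {V : normedModType R} (A : set V) (A0 : A !=set0).

Lemma inf_dist_ge0 x : 0 <= inf_dist A x.
Proof.
by apply: lb_le_inf => [|_ [a _ <-]//]; have [a Aa] := A0; exists `|x - a|, a.
Qed.

Lemma inf_dist_le x a : A a -> inf_dist A x <= `|x - a|.
Proof.
by move=> Aa; apply: ge_inf; [exists 0 => _ [b _ <-] | exists a].
Qed.

Lemma inf_dist_mem x : A x -> inf_dist A x = 0.
Proof.
move=> Ax; apply/eqP; rewrite eq_le inf_dist_ge0 andbT.
by have := @inf_dist_le x x Ax; rewrite subrr normr0.
Qed.

Lemma inf_dist_eq0 x : inf_dist A x = 0 -> closure A x.
Proof.
move=> x0; apply/closure_dist => e e0; apply: contrapT => nex.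
suff : e <= inf_dist A x by rewrite x0 leNgt e0.
apply: lb_le_inf => [|_ [a Aa <-]]; first by have [a Aa] := A0; exists `|x - a|, a.
by rewrite leNgt; apply/negP => xa; apply: nex; exists a.
Qed.

Lemma inf_dist_lip x x' : inf_dist A x <= `|x - x'| + inf_dist A x'.
Proof.
rewrite -lerBlDl; apply: lb_le_inf => [|_ [a Aa <-]].
  by have [a Aa] := A0; exists `|x' - a|, a.
rewrite lerBlDl (le_trans (inf_dist_le x Aa)) //.
by rewrite -(subrKA x') ler_normD.
Qed.

Lemma inf_dist_continuous : continuous (inf_dist A).
Proof.
move=> x; apply/cvgrPdist_lt => e e0; near=> z.
have xz : `|x - z| < e by near: z; exact: cvgr_dist_lt.
rewrite (le_lt_trans _ xz) // ler_norml; apply/andP; split.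
  by have := inf_dist_lip z x; rewrite distrC; lra.
by have := inf_dist_lip x z; lra.
Unshelve. all: by end_near. Qed.

End InfDist.

(** Take the distance to the complement of [D] minus the distance to the trace of [D] on [S]. The
    second vanishes on the trace, the first outside [D]. *)
Lemma exists_signed_dist (R : realType) (V : normedModType R) (S D : set V) :
  open D -> ~` D !=set0 -> D `&` S !=set0 ->
  exists s : V -> R, [/\ continuous s, forall x, S x -> D x -> 0 < s x,
    forall x, S x -> 0 <= s x -> closure (D `&` S) x &
    forall x, S x -> s x = 0 -> ~ D x].
Proof.
move=> oD D0 A0; pose d1 := inf_dist (~` D); pose d2 := inf_dist (D `&` S).
have d1_gt0 x : D x -> 0 < d1 x.
  move=> Dx; rewrite lt_def inf_dist_ge0 // andbT; apply/eqP => /(inf_dist_eq0 D0).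
  by have /closure_id <- := open_closedC oD.
have d2_0 x : S x -> D x -> d2 x = 0 by move=> Sx Dx; apply: inf_dist_mem.
have s_gt0 x : S x -> D x -> 0 < d1 x - d2 x.
  by move=> Sx Dx; rewrite d2_0 // subr0 d1_gt0.
exists (fun x => d1 x - d2 x); split=> // [|x Sx|x Sx s0 Dx].
- by apply: (@continuous_fun_sub _ _ R^o); apply: inf_dist_continuous.
- have [Dx _|nDx] := pselect (D x); first exact: subset_closure.
  rewrite /d1 inf_dist_mem // sub0r oppr_ge0 => d2_le0.
  by apply: inf_dist_eq0 => //; apply/eqP; rewrite eq_le d2_le0 inf_dist_ge0.
- by have := s_gt0 x Sx Dx; rewrite s0 ltxx.
Qed.

Lemma continuous_row (R : realType) (T : topologicalType) n (f : 'I_n -> T -> R) :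
  (forall i, continuous (f i)) -> continuous (fun x => \row_i f i x).
Proof.
move=> cf.
have -> : (fun x => \row_i f i x) = (fun x => \sum_i f i x *: delta_mx ord0 i).
  apply/funext => x; rewrite [LHS]row_sum_delta.
  by apply: eq_bigr => i _; rewrite mxE.
apply: continuous_fun_sum => i.
by apply: continuous_fun_scale => //; exact: cst_continuous.
Qed.

(** * Convex combinations in a cone *)

Lemma cone0 (R : realType) (X : normedModType R) (K : set X) : is_cone K -> K 0.
Proof. by move=> [_ _ _ K0]; have : [set 0 : X] 0 by []; rewrite -K0 => -[]. Qed.

Lemma cone_antisym (R : realType) (X : normedModType R) (K : set X) (u : X) :
  is_cone K -> K u -> K (- u) -> u = 0.
Proof.
move=> [_ _ _ K0] Ku KNu; suff : [set 0] u by [].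
by rewrite -K0; split=> //; exists (- u) => //; rewrite opprK.
Qed.

Lemma cone_sum (R : realType) (X : normedModType R) (K : set X) (I : Type)
    (r : seq I) (P : pred I) (w : I -> R) (c : I -> X) : is_cone K ->
  (forall i, 0 <= w i) -> (forall i, K (c i)) -> K (\sum_(i <- r | P i) w i *: c i).
Proof.
move=> cK w0 Kc; have [_ KD KZ _] := cK.
by apply: (big_ind K) => [|u v Ku Kv|i _]; [exact: cone0|exact: KD|exact: KZ].
Qed.

(** If the sum vanished, each term would be the opposite of the sum of the others, so it would lie
    in K and -K and be 0; all weights would then vanish. *)
Lemma cone_comb_neq0 (R : realType) (X : normedModType R) (K : set X) (I : finType)
    (w : I -> R) (c : I -> X) : is_cone K -> (forall i, 0 <= w i) ->
  \sum_i w i = 1 -> (forall i, K (c i)) -> (forall i, c i != 0) ->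
  \sum_i w i *: c i != 0.
Proof.
move=> cK w0 w1 Kc c0; apply/eqP => s0.
have wi i : w i = 0.
  apply/eqP; have : w i *: c i == 0; last by rewrite scaler_eq0 (negPf (c0 i)) orbF.
  have [_ _ KZ _] := cK; apply/eqP/(cone_antisym cK); first exact: KZ.
  have -> : - (w i *: c i) = \sum_(j | j != i) w j *: c j.
    by move/eqP: s0; rewrite (bigD1 i) //= addr_eq0 => /eqP ->; rewrite opprK.
  exact: cone_sum.
by move: w1; rewrite big1 // => /esym/eqP; rewrite oner_eq0.
Qed.

(* By compactness of the simplex. *)
Lemma cone_comb_norm_ge (R : realType) (X : normedModType R) (K : set X) m
    (c : 'I_m.+1 -> X) : is_cone K -> (forall i, K (c i)) -> (forall i, c i != 0) ->
  exists2 mu : R, 0 < mu & forall w : 'I_m.+1 -> R, (forall i, 0 <= w i) ->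
    \sum_i w i = 1 -> mu <= `|\sum_i w i *: c i|.
Proof.
move=> cK Kc c0.
pose A := [set v : 'rV[R]_m.+1 | forall i, v ord0 i \in `[0, 1]] `&`
  (fun v : 'rV[R]_m.+1 => \sum_i v ord0 i) @^-1` [set 1].
have memA (w : 'I_m.+1 -> R) : (forall i, 0 <= w i) -> \sum_i w i = 1 -> A (\row_i w i).
  move=> w0 w1; split=> [i|] /=; last by under eq_bigr do rewrite mxE.
  rewrite mxE in_itv /= w0 -w1 (bigD1 i) //= lerDl.
  by apply: sumr_ge0.
have A0 : A !=set0.
  exists (\row_i (i == ord0)%:R); apply: memA => [i|]; first by rewrite ler0n.
  by rewrite (bigD1 ord0) //= big1 ?addr0 // => i /negPf ->.
have cA : compact A.
  apply: compact_closedI.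
    by apply: (@rV_compact _ _ (fun=> `[0 : R, 1]%classic)) => _; exact: segment_compact.
  apply: closed_comp; last exact: closed_eq.
  by move=> v _; apply: (@continuous_fun_sum _ _ R^o) => i; exact: coord_continuous.
pose f (v : 'rV[R]_m.+1) := `|\sum_i v ord0 i *: c i|.
have cf : continuous f.
  apply: continuous_fun_norm; apply: continuous_fun_sum => i.
  apply: continuous_fun_scale; [exact: coord_continuous | exact: cst_continuous].
have [v /set_mem[v01 /= v1] vmin] := EVT_min_rV A0 cA (continuous_subspaceT cf).
exists (f v).
  rewrite normr_gt0; apply: cone_comb_neq0 cK _ v1 Kc c0.
  by move=> i; have := v01 i; rewrite in_itv => /andP[].
move=> w w0 w1; apply: le_trans (vmin _ (mem_set (memA w w0 w1))) _.
suff -> : \sum_i w i *: c i = \sum_i (\row_j w j) ord0 i *: c i by [].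
by apply: eq_bigr => i _; rewrite mxE.
Qed.

(** * The boundary problem for finitely many directions *)

Lemma finite_boundary_eigen (R : realType) (X : normedModType R) (K : set X)
    (y : X) (D : set X) m (c : 'I_m.+1 -> X) (p : 'I_m.+1 -> X -> R) :
  is_cone K -> open D -> bounded_set D -> D y -> ~` D !=set0 ->
  (forall i, K (c i)) -> (forall i, c i != 0) ->
  (forall i, continuous (p i)) -> (forall i x, 0 <= p i x) ->
  (forall x, \sum_i p i x = 1) ->
  exists x (lambda : R), [/\ rel_boundary (translate y K) (D `&` translate y K) x,
    0 < lambda & x = y + lambda *: \sum_i p i x *: c i].
Proof.
move=> cK oD bD Dy D0 Kc c0 cp p0 p1; set S := translate y K.
have Sy : S y by exists 0; [exact: cone0 | rewrite addr0].
have [|s [cs s_gt0 s_ge0 s_eq0]] := @exists_signed_dist R X S D oD D0; first by exists y.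
have [mu mu0 muP] := cone_comb_norm_ge cK Kc c0.
have [B B0 BP] : exists2 B : R, 0 < B & forall x, closure (D `&` S) x -> `|x - y| < B.
  have [M M0 MP] := bounded_closure bD (@subIsetl _ D S).
  exists (M + `|y| + 1) => [|x /MP xM]; first by rewrite ltr_wpDl // addr_ge0 // ltW.
  rewrite (le_lt_trans (ler_normB _ _)) // ltr_pwDr // lerD2r //.
(* With this choice [l = L] forces |x - y| >= L mu = B, which is impossible on the closure. *)
pose L : R := B / mu.
have L0 : 0 < L by rewrite divr_gt0.
(* For a general row [a] this point may leave [S]; the coefficients of the fixed point are
   nonnegative, which brings it back. *)
pose xa (a : 'rV[R]_m.+1) := y + \sum_i a ord0 i *: c i.
pose lam (a : 'rV[R]_m.+1) : R := Num.max 0 (Num.min L (\sum_i a ord0 i + s (xa a))).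
have cxa : continuous xa.
  apply: continuous_fun_add; first exact: cst_continuous.
  apply: continuous_fun_sum => i.
  by apply: continuous_fun_scale; [exact: coord_continuous | exact: cst_continuous].
have lam0 a : 0 <= lam a by rewrite le_max lexx.
have lamL a : lam a <= L by rewrite ge_max (ltW L0) ge_min lexx.
have c_comp (f : X -> R) : continuous f -> continuous (fun a => f (xa a)).
  by move=> cf a; exact: (@continuous_comp _ _ _ xa f a (cxa a) (cf _)).
have clam : continuous lam.
  apply: continuous_fun_max; first exact: cst_continuous.
  apply: continuous_fun_min; first exact: cst_continuous.
  apply: (@continuous_fun_add _ _ R^o); last exact: c_comp.
  by apply: (@continuous_fun_sum _ _ R^o) => i; exact: coord_continuous.
have [||a aE] := @brouwer R m (fun a => \row_i (lam a * p i (xa a))) L.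
- apply: continuous_row => i; apply: continuous_fun_mul => //.
  exact: c_comp.
- move=> a; apply: mx_norm_le => [|j i]; first exact: ltW.
  rewrite mxE ger0_norm ?mulr_ge0 // -[L]mulr1 ler_pM // -(p1 (xa a)).
  by rewrite (bigD1 i) //= lerDl sumr_ge0.
pose x := xa a; pose l := lam a.
have ai i : a ord0 i = l * p i x by rewrite -{1}aE mxE.
have xE : x = y + l *: \sum_i p i x *: c i.
  rewrite {1}/x /xa scaler_sumr; congr (_ + _); apply: eq_bigr => i _.
  by rewrite ai scalerA.
have Sx : S x.
  exists (l *: \sum_i p i x *: c i) => //.
  by have [_ _ KZ _] := cK; apply: KZ; [exact: lam0 | exact: cone_sum cK _ Kc].
have lE : l = Num.max 0 (Num.min L (l + s x)).
  rewrite {1}/l /lam; congr (Num.max _ (Num.min _ (_ + _))).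
  by under eq_bigr do rewrite ai; rewrite -mulr_sumr p1 mulr1.
(* If [l = 0] then [x = y], and clipping the positive number [s y] cannot give 0. *)
have l_gt0 : 0 < l.
  rewrite lt_def lam0 andbT; apply/eqP => l0.
  have xy : x = y by rewrite xE l0 scale0r addr0.
  have := s_gt0 y Sy Dy; move: lE; rewrite l0 add0r xy => /esym/eqP.
  rewrite eq_maxl ge_min => /orP[|] h1 h2.
    by have := lt_le_trans L0 h1; rewrite ltxx.
  by have := lt_le_trans h2 h1; rewrite ltxx.
(* A negative [s x] would make the clipped value smaller than [l]; a positive one would make it
   larger unless [l = L]. *)
have sx0 : s x = 0.
  case: (ltgtP (s x) 0) => // sx.
    suff : l < l by rewrite ltxx.
    rewrite [ltLHS]lE gt_max l_gt0 gt_min; apply/orP; right.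
    by rewrite gtrDl.
  have lL : l = L.
    apply/eqP; rewrite eq_le lamL /=; rewrite leNgt; apply/negP => lL.
    suff : l < l by rewrite ltxx.
    by rewrite [ltRHS]lE lt_max lt_min lL ltrDl sx orbT.
  have := BP x (s_ge0 x Sx (ltW sx)).
  rewrite {1}xE addrC addKr normrZ gtr0_norm // lL /L mulrAC ltNge.
  by rewrite ler_pdivlMr // ler_wpM2l ?muP // ltW.
exists x, l; split=> //; rewrite rel_boundaryE //.
by split; [split=> //; apply: s_ge0 => //; rewrite sx0 | exact: s_eq0].
Qed.

(** * Schauder approximation by finitely many values *)

Lemma continuous_fun_inv (R : realType) (T : topologicalType) (f : T -> R) :
  (forall x, f x != 0) -> continuous f -> continuous (fun x => (f x)^-1).
Proof. by move=> f0 cf x; exact: (cvgV (f0 x) (cf x)). Qed.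

(* The weights of the Schauder projection of f x onto the net z are extended by
   Tietze's theorem outside A, where the added term keeps their sum positive. *)
Lemma schauder_weights (R : realType) (X Y : normedModType R) (A : set X)
    (f : X -> Y) m (z : 'I_m.+1 -> Y) (e : R) :
  0 < e -> closed A -> {within A, continuous f} ->
  (forall x, A x -> exists i, `|f x - z i| < e / 2) ->
  exists p : 'I_m.+1 -> X -> R, [/\ forall i, continuous (p i),
    forall i x, 0 <= p i x, forall x, \sum_i p i x = 1 &
    forall x, A x -> `|\sum_i p i x *: z i - f x| <= e].
Proof.
move=> e0 clA cf net; have e2 : 0 < e / 2 by rewrite divr_gt0.
pose w i x := Num.max 0 (e - `|f x - z i|) : R.
have /choice[g gP] i : exists g : X -> R,
    continuous g /\ forall x, A x -> w i x = g x.
  have cw : {within A, continuous (w i : X -> R^o)}.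
    apply: (@continuous_fun_max _ (subspace A)); first exact: cst_continuous.
    apply: (@continuous_fun_sub _ (subspace A) R^o); first exact: cst_continuous.
    apply: (@continuous_fun_norm _ (subspace A)).
    by apply: (@continuous_fun_sub _ (subspace A)) => //; exact: cst_continuous.
  have [|g [gA cg _]] := continuous_bounded_extension pseudometric_normal clA e0 cw.
    move=> x _; rewrite ger0_norm ?le_max ?lexx // ge_max ltW //=.
    by rewrite gerBl.
  by exists g; split=> // x Ax; apply: gA; exact: mem_set.
pose h i x := Num.max 0 (g i x) : R.
(* This brings the total weight up to e/2 at least. On [A] it vanishes, since a net point within e/2
   of [f x] already has weight above e/2. *)
pose r x := Num.max 0 (e / 2 - \sum_i h i x) : R.
pose q i x := h i x + r x.
pose Q x := \sum_i q i x.
have h0 i x : 0 <= h i x by rewrite le_max lexx.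
have r0 x : 0 <= r x by rewrite le_max lexx.
have q0 i x : 0 <= q i x by rewrite addr_ge0.
have Q0 x : 0 < Q x.
  rewrite (lt_le_trans e2) // /Q big_split /=.
  apply: (@le_trans _ _ (\sum_i h i x + r x)).
    by rewrite addrC -lerBlDr le_max lexx orbT.
  by rewrite lerD2l (bigD1 ord0) //= lerDl sumr_ge0.
have ch i : continuous (h i).
  by apply: continuous_fun_max; [exact: cst_continuous | have [] := gP i].
have cr : continuous r.
  apply: continuous_fun_max; first exact: cst_continuous.
  apply: (@continuous_fun_sub _ _ R^o); first exact: cst_continuous.
  exact: (@continuous_fun_sum _ _ R^o).
have cq i : continuous (q i) by exact: (@continuous_fun_add _ _ R^o).
have p1 x : \sum_i q i x / Q x = 1 by rewrite -mulr_suml -/(Q x) divff // gt_eqF.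
exists (fun i x => q i x / Q x); split=> // [i|i x|x Ax].
- apply: continuous_fun_mul => //; apply: continuous_fun_inv => [x|].
    by rewrite gt_eqF.
  exact: (@continuous_fun_sum _ _ R^o).
- by rewrite divr_ge0 // ltW.
have hw i : h i x = w i x.
  by rewrite /h; have [_ /(_ x Ax) <-] := gP i; rewrite max_r // le_max lexx.
have rx : r x = 0.
  apply: max_l; rewrite subr_le0; have [i xi] := net x Ax.
  rewrite (bigD1 i) //= hw; apply: (@le_trans _ _ (e - `|f x - z i|)); first by lra.
  rewrite (@le_trans _ _ (w i x)) //; first by rewrite le_max lexx orbT.
  by rewrite lerDl sumr_ge0.
have -> : f x = \sum_i (q i x / Q x) *: f x by rewrite -scaler_suml p1 scale1r.
rewrite -sumrB (le_trans (ler_norm_sum _ _ _)) //.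
rewrite -[leRHS]mul1r -(p1 x) mulr_suml; apply: ler_sum => i _.
rewrite -scalerBr normrZ ger0_norm ?divr_ge0 // ?(ltW (Q0 x)) //.
have [xi|xi] := leP `|f x - z i| e.
  by rewrite ler_wpM2l ?divr_ge0 // ?(ltW (Q0 x)) // distrC.
have -> : q i x = 0; last by rewrite !mul0r.
by rewrite /q rx hw addr0; apply: max_l; rewrite subr_le0 ltW.
Qed.

(** The balls centred in [A] itself already cover its closure. Centres in [A] are wanted because
    values of the map on the boundary lie in the cone and are bounded away from 0. *)
Lemma compact_finite_net (R : realType) (V : normedModType R) (A : set V) (e : R) :
  0 < e -> A !=set0 -> compact (closure A) ->
  exists m (z : 'I_m.+1 -> V), (forall i, A (z i)) /\
    forall x, A x -> exists i, `|x - z i| < e.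
Proof.
move=> e0 A0; rewrite compact_cover => /(_ V A (fun a => ball a e)).
case=> [a Aa|x /closure_dist/(_ e e0)[a Aa xa]|B BA cov].
- exact: ball_open.
- by exists a => //; rewrite -ball_normE /= distrC.
have net x : A x -> exists2 a, a \in B & `|x - a| < e.
  move=> /(@subset_closure _ A)/cov[a aB]; rewrite -ball_normE /= distrC.
  by exists a.
have [a Aa] := A0; have [b bB _] := net a Aa.
pose s := enum_fset B.
have sB : (size s).-1.+1 = size s by rewrite prednK // -has_predT; apply/hasP; exists b.
exists (size s).-1, (fun i => nth a s i); split=> [i|x Ax].
  by apply/set_mem/BA/mem_nth; apply: leq_trans (ltn_ord i) _; rewrite sB.
have [c cB xc] := net x Ax.
have ic : (index c s < (size s).-1.+1)%N by rewrite sB index_mem.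
by exists (Ordinal ic); rewrite /= nth_index.
Qed.

(** * Passage to the limit and conclusion *)

Lemma ereal_inf_gt0 (R : realType) (T : Type) (A : set T) (f : T -> R) :
  (0 < ereal_inf [set (f x)%:E | x in A])%E ->
  exists2 delta : R, 0 < delta & forall x, A x -> delta <= f x.
Proof.
set e := ereal_inf _; have eP x : A x -> (e <= (f x)%:E)%E.
  by move=> Ax; apply: ereal_inf_lbound; exists x.
(* The infimum is infinite only for empty [A], where 1 serves as well as any bound. *)
move: eP; case: e => [r||//] eP; last first.
  by move=> _; exists 1 => // x /eP; rewrite leye_eq.
by rewrite lte_fin => r0; exists r => // x /eP; rewrite lee_fin.
Qed.

Lemma closed_translate (R : realType) (X : normedModType R) (y : X) (K : set X) :
  closed K -> closed (translate y K).
Proof.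
move=> cK; have -> : translate y K = (fun x => x - y) @^-1` K.
  apply/seteqP; split=> [_ [u Ku <-]|x Kx]; first by rewrite /= addrC addKr.
  by exists (x - y) => //; rewrite addrC subrK.
apply: closed_comp => // x _.
by apply: continuous_fun_sub; [move=> z; exact: cvg_id | exact: cst_continuous].
Qed.

(* Approximate solutions converge along a subsequence to an exact one, because
   both lambda and f x range over compact sets. *)
Lemma limit_eigen (R : realType) (X : normedModType R) (A : set X) (f : X -> X)
    (y : X) (L : R) :
  closed A -> {within A, continuous f} -> compact (closure (f @` A)) ->
  (forall e : R, 0 < e -> exists x lambda, [/\ A x, 0 <= lambda, lambda <= L &
     `|x - (y + lambda *: f x)| <= e]) ->
  exists x lambda, [/\ A x, 0 <= lambda & x = y + lambda *: f x].
Proof.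
move=> clA cf cfA approx.
have /choice[x /choice[l xlP]] n : exists x lambda, [/\ A x, 0 <= lambda,
    lambda <= L & `|x - (y + lambda *: f x)| <= n.+1%:R^-1].
  by apply: approx; rewrite invr_gt0.
have cP : compact (`[0 : R, L]%classic `*` closure (f @` A)).
  by apply: compact_setX => //; exact: segment_compact.
have [|[l' z] /= [l'0L _] clP] :=
    @compact_seq_cluster R (R^o * X)%type _ (fun n => (l n, f (x n))) cP.
  move=> n; have [Ax l0 lL _] := xlP n; split=> /=; first by rewrite in_itv /= l0.
  by apply: subset_closure; exists (x n).
pose x' := y + l' *: z.
have near_x' (e : R) : 0 < e ->
    exists2 n, `|x' - x n| < e & `|z - f (x n)| < e.
  (* The three terms of [C] account for the error of the approximate equation, for [l n] against
     [l'], and for [f (x n)] against [z]. *)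
  move=> e0; pose C := 1 + `|z| + `|L|.
  have C0 : 0 < C by rewrite /C -addrA ltr_pwDl // addr_ge0.
  have C1 : 1 <= C by rewrite /C -addrA lerDl addr_ge0.
  pose d := e / C; have d0 : 0 < d by rewrite divr_gt0.
  pose N := Num.bound d^-1.
  have [n Nn] := clP d d0 N; rewrite prod_normE /= gt_max => /andP[ln zn].
  exists n; last first.
    by rewrite (lt_le_trans zn) // ler_pdivrMr // ler_peMr // ltW.
  have [_ l0 lL xn] := xlP n.
  have nd : n.+1%:R^-1 < d.
    rewrite -[d]invrK ltf_pV2 ?posrE ?invr_gt0 //.
    rewrite (lt_le_trans (archi_boundP _)) ?invr_ge0 ?(ltW d0) // ler_nat.
    exact: leqW.
  have -> : x' - x n = (y + l n *: f (x n) - x n) +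
      ((l' - l n) *: z + l n *: (z - f (x n))).
    rewrite /x' scalerBl scalerBr subrKA [RHS]addrAC addrACA.
    by rewrite subrr addr0.
  have -> : e = d + (d * `|z| + `|L| * d).
    have dC : d * C = e by rewrite divfK // gt_eqF.
    by rewrite -[LHS]dC /C; ring.
  rewrite (le_lt_trans (ler_normD _ _)) // ltr_leD //.
    by rewrite distrC (le_lt_trans xn).
  rewrite (le_trans (ler_normD _ _)) // lerD // normrZ.
    by rewrite ler_wpM2r // ltW.
  by rewrite ler_pM // ?(ltW zn) // ger0_norm // (le_trans lL) // ler_norm.
have Ax' : A x'.
  have /closure_id -> := clA; apply/closure_dist => e e0.
  have [n xn _] := near_x' e e0; exists (x n) => //.
  by have [] := xlP n.
have fx' : f x' = z.
  apply/eqP; rewrite -subr_eq0 -normr_eq0 eq_le normr_ge0 andbT leNgt.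
  apply/negP => fz0; set e := `|_| in fz0.
  have e2 : 0 < e / 2 by rewrite divr_gt0.
  have /subspace_continuousP/(_ x' Ax')/cvgrPdist_lt/(_ _ e2) := cf.
  rewrite near_withinE => /nbhs_normP[d /= d0 dP].
  have [|n xn zn] := near_x' (Num.min d (e / 2)); first by rewrite lt_min d0.
  move: xn zn; rewrite !lt_min => /andP[xn _] /andP[_ zn].
  have [Axn _ _ _] := xlP n; have fxn := dP _ xn Axn.
  suff : e < e by rewrite ltxx.
  rewrite [ltRHS](splitr e) {1}/e -(subrKA (f (x n))) (le_lt_trans (ler_normD _ _)) //.
  by rewrite ltrD // distrC.
exists x', l'; split=> //; last by rewrite fx'.
by move: l'0L; rewrite in_itv => /andP[].
Qed.

Theorem corollary2p4 (R : realType) (X : completeNormedModType R)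
    (K : set X) (y : X) (D : set X) (F : X -> X) :
  let Ky := translate y K in
  let DKy := D `&` Ky in
  is_cone K ->
  open D ->
  bounded_set D ->
  DKy y ->
  rel_closure Ky DKy <> Ky ->
  compact_map (rel_closure Ky DKy) K F ->
  (0 < ereal_inf [set `|F x|%:E | x in rel_boundary Ky DKy])%E ->
  exists (x : X) (lambda : R),
    [/\ rel_boundary Ky DKy x, 0 < lambda & x = y + lambda *: F x].
Proof.
move=> Ky DKy cK oD bD [Dy Sy] ncl [Fim cF pF] inf_gt0.
set Bd := rel_boundary Ky DKy.
have BdE : Bd = Ky `&` closure DKy `\` D by exact: rel_boundaryE.
have clKy : closed Ky by have [clK _ _ _] := cK; exact: closed_translate.
have clBd : closed Bd.
  rewrite BdE setDE; apply: closedI; last exact: open_closedC.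
  by apply: closedI => //; exact: closed_closure.
have BdA : Bd `<=` rel_closure Ky DKy by rewrite /Bd /rel_boundary => x [].
have clE : rel_closure Ky DKy = Ky `&` closure DKy.
  by apply: rel_closureE => x [].
have [z Sz ncz] : exists2 z, Ky z & ~ closure DKy z.
  apply: contrapT => nex; apply: ncl; rewrite clE.
  apply/seteqP; split=> [x []//|x Sx]; split=> //.
  by apply: contrapT => ncx; apply: nex; exists x.
have nDz : ~ D z by move=> Dz; apply: ncz; exact: subset_closure.
have D0 : ~` D !=set0 by exists z.
have [M M0 MP] : exists2 M : R, 0 < M & forall x, closure DKy x -> `|x| <= M.
  exact: bounded_closure bD (@subIsetl _ D Ky).
(* The finite problem with the single vector [u], where z = y + u, and the constant weight 1
   supplies a boundary point. *)
have Bd0 : Bd !=set0.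
  have [u Ku uz] := Sz.
  have u0 : u != 0 by apply: contra_notN nDz => /eqP u0; rewrite -uz u0 addr0.
  have [|||x [l []]] := @finite_boundary_eigen R X K y D 0%N (fun=> u) (fun _ => cst 1)
    cK oD bD Dy D0 (fun=> Ku) (fun=> u0); last by exists x.
  - by move=> _; exact: cst_continuous.
  - by move=> _ x; exact: ler01.
  - by move=> x; rewrite big_ord1.
have cFBd : {within Bd, continuous F} by exact: continuous_subspaceW cF.
have cmp : compact (closure (F @` Bd)).
  rewrite -precompactE; apply: pF => //.
  exists M; split=> [|N MN x]; first exact: num_real.
  by rewrite BdE => -[[_ /MP xM] _] /=; rewrite (le_trans xM) // ltW.
have [delta delta0 deltaP] := ereal_inf_gt0 inf_gt0.
(* A bound for the approximate eigenvalues: [M + |y|] bounds |x - y|, and delta/2 bounds the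
   approximating combination from below. *)
pose L := (M + `|y|) / (delta / 2).
have L0 : 0 <= L by rewrite !(divr_ge0, addr_ge0) // ltW.
have [e e0|x [l [Bx l0 xE]]] := @limit_eigen R X Bd F y L clBd cFBd cmp; last first.
  (* A zero eigenvalue would give [x = y], which lies in [D], whereas [Bd] avoids [D]. *)
  exists x, l; split=> //; rewrite lt_def l0 andbT; apply/eqP => l_eq0.
  by move: Bx; rewrite BdE xE l_eq0 scale0r addr0 => -[_].
(* The first bound keeps the combination at norm at least delta/2; the second makes the error l |g -
   F x| at most [e]. *)
pose e' := Num.min (delta / 2) (e / (L + 1)).
have e'0 : 0 < e' by rewrite lt_min !divr_gt0 // ltr_wpDl.
have [||m [c [cBd net]]] := @compact_finite_net R X (F @` Bd) (e' / 2) _ _ cmp.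
- by rewrite divr_gt0.
- by have [x Bx] := Bd0; exists (F x), x.
have Fdelta x : (F @` Bd) x -> delta <= `|x| by move=> [b /deltaP ? <-].
have [|p [cp p0 p1 pF']] := schauder_weights e'0 clBd cFBd (z := c).
  by move=> x Bx; apply: net; exists x.
have [|||||x [l [Bx l0 xE]]] := @finite_boundary_eigen R X K y D m c p cK oD bD Dy D0.
- move=> i; have [b Bb <-] := cBd i; apply: Fim; exists b => //.
  exact: BdA.
- by move=> i; rewrite -normr_gt0 (lt_le_trans delta0) // Fdelta.
- exact: cp.
- exact: p0.
- exact: p1.
set g := \sum_i _ in xE.
have gF : `|g - F x| <= e' by exact: pF'.
have g_ge : delta / 2 <= `|g|.
  have : `|g - F x| <= delta / 2 by rewrite (le_trans gF) // ge_min lexx.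
  have := deltaP x Bx; have := ler_normD g (F x - g).
  by rewrite addrC subrK distrC; lra.
have lL : l <= L.
  rewrite ler_pdivlMr ?divr_gt0 //.
  apply: (@le_trans _ _ (l * `|g|)); first by rewrite ler_wpM2l // ltW.
  have -> : l * `|g| = `|x - y|.
    by rewrite xE addrC addKr normrZ gtr0_norm.
  rewrite (le_trans (ler_normB _ _)) // lerD2r MP //.
  by move: Bx; rewrite -/Bd BdE => -[[]].
exists x, l; split=> //; first exact: ltW.
rewrite {1}xE opprD addrACA subrr add0r -scalerBr normrZ gtr0_norm //.
apply: (@le_trans _ _ ((L + 1) * (e / (L + 1)))).
  apply: ler_pM => //; first exact: ltW.
    by rewrite (le_trans lL) // lerDl.
  by rewrite (le_trans gF) // ge_min lexx orbT.
by rewrite mulrC divfK // gt_eqF // ltr_wpDl.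
Qed.
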